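(* For every integer $k\ge 1$, every vector $\beta \in \{0,1\}^k$ and every graph $G$, the total number of $\beta$-closed walks in $G$ can be expanded as $$n_\beta(G) = \sum_{H\in\mathcal{U}_{\le k}} s_\beta(H)\operatorname{ind}(H,G),$$ where the number $s_\beta(H)$ of surjective $\beta$-closed walks on $H$ is given by $$s_\beta(H) = \sum_{L \in \mathcal{U}_{\le |V(H)|}} (-1)^{|V(H)|-|V(L)|} \operatorname{tr}\left(\prod_{i=1}^k M_{\beta_i}(L)\right) \operatorname{ind}(L, H).$$
   Context: All graphs are finite, simple and undirected. $A(G)$ denotes the adjacency matrix of $G$ and $\overline{G}$ its complement; $M_1(G)=A(G)$ and $M_0(G)=A(\overline{G})$, and matrix products are taken in the order $i=1,\dots,k$. For $\beta=(\beta_1,\dots,\beta_k)\in\{0,1\}^k$, a $\beta$-closed walk in $G$ is a sequence of vertices $v_1,\dots,v_{k+1}$ with $v_{k+1}=v_1$ such that for each $i\in\{1,\dots,k\}$, $v_iv_{i+1}$ is an edge of $G$ if $\beta_i=1$, and an edge of $\overline{G}$ if $\beta_i=0$. $n_\beta(G)$ denotes the total number of $\beta$-closed walks in $G$. A $\beta$-closed walk $v_1,\dots,v_{k+1}$ in a graph $H$ is surjective if $\{v_1,\dots,v_k\}=V(H)$; $s_\beta(H)$ is the number of surjective $\beta$-closed walks on $H$. For $\ell\ge1$, $\mathcal{U}_{\le \ell}$ is the set of isomorphism classes of nonempty graphs (at least one vertex) with at most $\ell$ vertices. $\operatorname{ind}(H,G)$ is the number of induced subgraphs of $G$ isomorphic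 to $H$, i.e. the number of vertex subsets $S\subseteq V(G)$ with $G[S]\cong H$. *)

(* Defs.v *)
From HB Require Import structures.
From mathcomp Require Import all_boot all_order all_algebra.

Set Implicit Arguments.
Unset Strict Implicit.
Unset Printing Implicit Defensive.

(* A simple graph with vertex set V is given by its set of ordered adjacent
   pairs, so that [graph V] is a finite type. *)
Definition simple (V : finType) (E : {set V * V}) : bool :=
  [forall x, (x, x) \notin E] &&
  [forall x, forall y, ((x, y) \in E) == ((y, x) \in E)].

Record graph (V : finType) := Graph { edges : {set V * V}; _ : simple edges }.

HB.instance Definition _ (V : finType) := [isSub for @edges V].
HB.instance Definition _ (V : finType) := [Finite of graph V by <:].

Definition adj (V : finType) (G : graph V) (x y : V) : bool :=
  (x, y) \in edges G.

Lemma adj_irrefl (V : finType) (G : graph V) : irreflexive (adj G).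
Proof.
by rewrite /adj; case: G => E /= /andP[/forallP irrE _] x; apply/negbTE.
Qed.

Lemma adj_sym (V : finType) (G : graph V) : symmetric (adj G).
Proof.
rewrite /adj; case: G => E /= /andP[_ /forallP symE] x y.
by apply/eqP; move/forallP: (symE x).
Qed.

Lemma compl_simple (V : finType) (G : graph V) :
  simple [set p : V * V | (p.1 != p.2) && ~~ adj G p.1 p.2].
Proof.
apply/andP; split; first by apply/forallP => x; rewrite inE /= eqxx.
by apply/forallP => x; apply/forallP => y; rewrite !inE /= (eq_sym x) adj_sym.
Qed.

Definition compl (V : finType) (G : graph V) : graph V := Graph (compl_simple G).

Lemma induced_simple (V : finType) (G : graph V) (S : {set V}) :
  simple [set p : {x : V | x \in S} * {x : V | x \in S} |
           adj G (val p.1) (val p.2)].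
Proof.
apply/andP; split; first by apply/forallP => x; rewrite inE /= adj_irrefl.
by apply/forallP => x; apply/forallP => y; rewrite !inE /= adj_sym.
Qed.

Definition induced (V : finType) (G : graph V) (S : {set V}) :
  graph {x : V | x \in S} := Graph (induced_simple G S).

Definition iso (V W : finType) (G : graph V) (H : graph W) : bool :=
  [exists f : {ffun V -> W},
    [&& injectiveb f, [forall y, y \in codom f]
      & [forall x, forall y, adj H (f x) (f y) == adj G x y]]].

Lemma isoP (V W : finType) (G : graph V) (H : graph W) :
  reflect (exists2 f : V -> W, bijective f & {mono f : x y / adj G x y >-> adj H x y})
          (iso G H).
Proof.
apply: (iffP existsP) => [[f /and3P[/injectiveP injf /forallP surf /forallP fG]]|].
  exists f => [|x y]; last by move/forallP: (fG x) => /(_ y)/eqP.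
  exists (fun y => iinv (surf y)) => [x|y]; last exact: f_iinv.
  by apply: injf; rewrite f_iinv.
case=> f [g fK gK] fG; exists (finfun f); apply/and3P; split.
- by apply/injectiveP => x y; rewrite !ffunE; apply: (can_inj fK).
- by apply/forallP => y; apply/codomP; exists (g y); rewrite ffunE gK.
- by apply/forallP => x; apply/forallP => y; rewrite !ffunE fG.
Qed.

Lemma iso_refl (V : finType) (G : graph V) : iso G G.
Proof. by apply/isoP; exists id => //; exists id. Qed.

Lemma iso_sym (V W : finType) (G : graph V) (H : graph W) : iso G H = iso H G.
Proof.
suff imp (V' W' : finType) (G' : graph V') (H' : graph W') : iso G' H' -> iso H' G'.
  by apply/idP/idP; apply: imp.
case/isoP=> f [g fK gK] fG; apply/isoP; exists g; first by exists f.
by move=> x y; rewrite -fG !gK.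
Qed.

Lemma iso_trans (U V W : finType) (F : graph U) (G : graph V) (H : graph W) :
  iso F G -> iso G H -> iso F H.
Proof.
case/isoP=> f bf fF /isoP[g bg gG]; apply/isoP.
by exists (g \o f) => [|x y] /=; [exact: bij_comp | rewrite gG fF].
Qed.

Definition ind (V W : finType) (H : graph W) (G : graph V) : nat :=
  #|[set S : {set V} | iso (induced G S) H]|.

(* Every nonempty graph with at most l vertices is isomorphic to one with
   vertex set 'I_n for some 0 < n <= l. *)
Definition small_graph (l : nat) : finType := {n : 'I_l.+1 & graph 'I_n}.

Definition small_iso (l : nat) : rel (small_graph l) :=
  fun H K => iso (tagged H) (tagged K).

Lemma small_iso_equiv (l : nat) : equivalence_rel (@small_iso l).
Proof.
move=> F G H; split=> [|FG]; first exact: iso_refl.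
apply/idP/idP; last exact: iso_trans.
by apply: iso_trans; rewrite iso_sym.
Qed.

Definition nonempty_graphs (l : nat) : {set small_graph l} :=
  [set H : small_graph l | 0 < tag H].

(* The isomorphism classes of nonempty graphs with at most l vertices, each
   given by one representative. *)
Definition unlabelled (l : nat) : {set small_graph l} :=
  transversal (equivalence_partition (@small_iso l) (nonempty_graphs l))
              (nonempty_graphs l).

Section Walks.
Variables (V : finType) (G : graph V) (k : nat) (beta : k.-tuple bool).

(* The entries v_1, ..., v_(k+1) of a walk are those of index 0, ..., k here. *)
Definition closed_walk (v : k.+1.-tuple V) : bool :=
  (tnth v ord_max == tnth v ord0) &&
  [forall i : 'I_k,
    adj (if tnth beta i then G else compl G)
        (tnth v (widen_ord (leqnSn k) i)) (tnth v (lift ord0 i))].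

Definition surjective_walk (v : k.+1.-tuple V) : bool :=
  [set tnth v (widen_ord (leqnSn k) i) | i : 'I_k] == [set: V].

Definition num_closed_walks : nat := #|[set v | closed_walk v]|.

Definition num_surjective_closed_walks : nat :=
  #|[set v | closed_walk v && surjective_walk v]|.

End Walks.

Local Open Scope ring_scope.

Definition adjmx (V : finType) (G : graph V) : 'M[int]_#|V| :=
  \matrix_(i, j) (adj G (enum_val i) (enum_val j))%:R.

Definition Mmx (b : bool) (V : finType) (G : graph V) : 'M[int]_#|V| :=
  if b then adjmx G else adjmx (compl G).

(* Main.v *)
(** Every closed walk of length k >= 1 visits a nonempty vertex set S with at
    most k elements, and is then a surjective closed walk on G[S]; grouping the
    sets S by the isomorphism class of G[S] gives the first formula.  On H, the
    closed walks visiting only vertices of S are those of H[S], and there are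
    tr(prod M) of them, so the second formula is inclusion-exclusion over the
    subsets S of V(H), grouped in the same way. *)

Require Import Defs.
From mathcomp Require Import all_boot all_order all_algebra.

Set Implicit Arguments.
Unset Strict Implicit.
Unset Printing Implicit Defensive.

Import GRing.Theory.

(** * The vertices visited by a walk *)

Definition walk_support (V : finType) (k : nat) (v : k.+1.-tuple V) : {set V} :=
  [set tnth v (widen_ord (leqnSn k) i) | i : 'I_k].

Lemma walk_support_gt0 (V : finType) (k : nat) (v : k.+1.-tuple V) :
  0 < k -> 0 < #|walk_support v| <= k.
Proof.
move=> k_gt0; apply/andP; split.
  by apply/card_gt0P; exists (tnth v (widen_ord (leqnSn k) (Ordinal k_gt0)));
     apply: imset_f.
by rewrite -[leqRHS]card_ord; apply: leq_imset_card.
Qed.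

(** The support omits index [k], but a closed walk repeats there its entry of index 0, and 0 is
    below [k]. *)
Lemma closed_walk_tnth_support (V : finType) (G : graph V) (k : nat)
    (beta : k.-tuple bool) (v : k.+1.-tuple V) (j : 'I_k.+1) :
  0 < k -> closed_walk G beta v -> tnth v j \in walk_support v.
Proof.
move=> k_gt0 /andP[/eqP v_closed _].
have in_supp (i : 'I_k.+1) : i < k -> tnth v i \in walk_support v.
  by move=> ltik; apply/imsetP; exists (Ordinal ltik) => //; congr tnth; apply: val_inj.
have [/in_supp //|lekj] := ltnP j k.
have ->: j = ord_max by apply/val_inj/eqP; rewrite eqn_leq -ltnS ltn_ord lekj.
by rewrite v_closed; apply: in_supp.
Qed.

(** * Transport of walks along induced embeddings *)

Section WalkImage.
Variables (V W : finType) (G : graph V) (H : graph W) (f : W -> V).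
Hypotheses (f_inj : injective f) (fG : {mono f : x y / adj H x y >-> adj G x y}).
Variables (k : nat) (beta : k.-tuple bool).

Lemma closed_walk_map (w : k.+1.-tuple W) :
  closed_walk G beta (map_tuple f w) = closed_walk H beta w.
Proof.
rewrite /closed_walk !tnth_map (inj_eq f_inj); congr (_ && _).
apply: eq_forallb => i; rewrite !tnth_map; case: ifP => _; first exact: fG.
by rewrite /adj !inE /= (inj_eq f_inj) fG.
Qed.

Lemma walk_support_map (w : k.+1.-tuple W) :
  walk_support (map_tuple f w) = f @: walk_support w.
Proof.
rewrite /walk_support -imset_comp; apply: eq_imset => i /=.
by rewrite tnth_map.
Qed.

(** Applying [f] entrywise is injective on walks and reaches exactly the closed walks that stay in
    the image of [f]. The predicate [P] lets one count serve both for walks whose support is a given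
    set and for walks inside that set. *)
Lemma card_closed_walks_image (P : pred {set V}) : 0 < k ->
  #|[set w : k.+1.-tuple W | closed_walk H beta w && P (f @: walk_support w)]|
  = #|[set v : k.+1.-tuple V | [&& closed_walk G beta v,
        walk_support v \subset f @: setT & P (walk_support v)]]|.
Proof.
move=> k_gt0.
have map_inj : injective (map_tuple f : k.+1.-tuple W -> _).
  by move=> u v /(congr1 val) /(inj_map f_inj) /val_inj.
rewrite -(card_imset _ map_inj); apply: eq_card => v; rewrite inE.
apply/imsetP/and3P => [[w + ->]|[v_closed /subsetP supp_v Pv]].
  rewrite inE -closed_walk_map -walk_support_map => /andP[-> ->]; split=> //.
  by rewrite walk_support_map imsetS ?subsetT.
(* All entries of [v], including the last, lie in the image because [v] is closed; choosing
   preimages pulls [v] back to [W]. *)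
have /fin_all_exists[g gE] (j : 'I_k.+1) : exists x, tnth v j = f x.
  have /supp_v/imsetP[x _ ->] := closed_walk_tnth_support j k_gt0 v_closed.
  by exists x.
have vE : v = map_tuple f [tuple g j | j < k.+1].
  by apply: eq_from_tnth => j; rewrite tnth_map tnth_mktuple.
by exists [tuple g j | j < k.+1] => //;
   rewrite inE -closed_walk_map -walk_support_map -vE v_closed.
Qed.

End WalkImage.

(** The embedding is the inverse isomorphism followed by the inclusion of [S] in [V]. *)
Lemma iso_induced_embedding (V W : finType) (G : graph V) (S : {set V})
    (H : graph W) :
  iso (induced G S) H ->
  exists f : W -> V,
    [/\ injective f, {mono f : x y / adj H x y >-> adj G x y} & f @: setT = S].
Proof.
case/isoP=> h [g hK gK] hG; exists (val \o g); split.
- exact: (inj_comp val_inj (can_inj gK)).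
- by move=> x y; rewrite -{2}(gK x) -{2}(gK y) hG [RHS]/adj inE.
apply/setP=> x; apply/imsetP/idP => [[y _ ->]|Sx]; first exact: valP.
by exists (h (Sub x Sx)) => //=; rewrite hK.
Qed.

Lemma card_iso_induced (V W : finType) (G : graph V) (S : {set V})
    (H : graph W) :
  iso (induced G S) H -> #|S| = #|W|.
Proof. by case/iso_induced_embedding=> f [f_inj _ <-]; rewrite card_imset ?cardsT. Qed.

Lemma num_surjective_closed_walks_iso (V W : finType) (G : graph V)
    (S : {set V}) (H : graph W) (k : nat) (beta : k.-tuple bool) : 0 < k ->
  iso (induced G S) H ->
  num_surjective_closed_walks H beta
  = #|[set v | closed_walk G beta v && (walk_support v == S)]|.
Proof.
move=> k_gt0 /iso_induced_embedding[f [f_inj fG fS]].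
transitivity #|[set w | closed_walk H beta w && (f @: walk_support w == S)]|.
  by apply: eq_card => w; rewrite !inE -fS (inj_eq (imset_inj f_inj)).
rewrite (card_closed_walks_image f_inj fG beta (pred1 S)) // fS.
apply: eq_card => v; rewrite !inE; congr andb => /=.
by case: eqP => [->|_]; rewrite ?subxx ?andbF.
Qed.

Lemma num_closed_walks_iso (V W : finType) (G : graph V) (S : {set V})
    (H : graph W) (k : nat) (beta : k.-tuple bool) : 0 < k ->
  iso (induced G S) H ->
  num_closed_walks H beta
  = #|[set v | closed_walk G beta v && (walk_support v \subset S)]|.
Proof.
move=> k_gt0 /iso_induced_embedding[f [f_inj fG fS]].
transitivity #|[set w | closed_walk H beta w && predT (f @: walk_support w)]|.
  by apply: eq_card => w; rewrite !inE andbT.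
rewrite (card_closed_walks_image f_inj fG beta predT) // fS.
by apply: eq_card => v; rewrite !inE andbT.
Qed.

(** * Representatives of isomorphism classes *)

Lemma unlabelled_transversal (l : nat) :
  is_transversal (unlabelled l)
    (equivalence_partition (@small_iso l) (nonempty_graphs l))
    (nonempty_graphs l).
Proof.
by apply/transversalP/equivalence_partitionP => ? ? ? _ _ _; apply: small_iso_equiv.
Qed.

(** Existence and uniqueness of the representative are stated as an equality with [pred1 H], so that
    a sum over the representatives isomorphic to [G] collapses to one term. *)
Lemma unlabelled_iso_unique (V : finType) (G : graph V) (l : nat) :
  0 < #|V| <= l ->
  exists H : small_graph l,
    (fun K => (K \in unlabelled l) && iso G (tagged K)) =1 pred1 H.
Proof.
case/andP=> V_gt0 leVl.
(* A copy of [G] on an ordinal, as [small_graph] requires, obtained by numbering the vertices. *)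
pose fE := [set p : 'I_#|V| * 'I_#|V| | adj G (enum_val p.1) (enum_val p.2)].
have fE_simple : simple fE.
  apply/andP; split; first by apply/forallP => x; rewrite inE /= adj_irrefl.
  by apply/forallP => x; apply/forallP => y; rewrite !inE /= adj_sym.
pose ltVl : #|V| < l.+1 := leVl.
pose K0 : small_graph l := Tagged (fun n : 'I_l.+1 => graph 'I_n)
  (Graph fE_simple : graph 'I_(Ordinal ltVl)).
have isoK0 : iso G (tagged K0).
  rewrite iso_sym; apply/isoP; exists enum_val; first exact: enum_val_bij.
  by move=> x y; rewrite [RHS]/adj inE.
have K0D : K0 \in nonempty_graphs l by rewrite inE.
have eqR := in3W (@small_iso_equiv l) : {in nonempty_graphs l & &, _}.
have trX := unlabelled_transversal l.
have sXD := transversal_sub trX.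
have /andP[Ppart _] := trX; have /and3P[_ tiP _] := Ppart.
pose P := equivalence_partition (@small_iso l) (nonempty_graphs l).
have PK0 : pblock P K0 \in P by rewrite pblock_mem // (cover_partition Ppart).
pose H := transversal_repr K0 (unlabelled l) (pblock P K0).
have XH : H \in unlabelled l := repr_mem_transversal trX K0 PK0.
have isoK0H : iso (tagged K0) (tagged H).
  have := repr_mem_pblock trX K0 PK0.
  by rewrite pblock_equivalence_partition // (subsetP sXD).
exists H => K /=; apply/andP/eqP => [[XK isoGK]|->]; last first.
  by split=> //; apply: iso_trans isoK0H.
(* Uniqueness: [K] lies in the block of [K0], and the transversal meets each block only once. *)
have KD : K \in nonempty_graphs l := subsetP sXD K XK.
have /(same_pblock tiP) eqPK : K \in pblock P K0.
  rewrite pblock_equivalence_partition //.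
  by apply: iso_trans isoGK; rewrite iso_sym.
by rewrite /H -eqPK (pblockK trX K0 XK).
Qed.

Local Open Scope ring_scope.

(** Double counting of the pairs $(S,H)$ with $G[S]\cong H$: each $S$ of admissible size has exactly
    one $H$, and each $H$ has [ind (tagged H) G] sets $S$. The values lie in any [nmodType], to
    cover both the natural and the integer formula. *)
Lemma sum_unlabelled (R : nmodType) (V : finType) (G : graph V) (l : nat)
    (F : {set V} -> R) (f : small_graph l -> R) :
  (forall (S : {set V}) H, iso (induced G S) (tagged H) -> F S = f H) ->
  \sum_(S : {set V} | (0 < #|S| <= l)%N) F S
  = \sum_(H in unlabelled l) f H *+ ind (tagged H) G.
Proof.
move=> Ff.
transitivity (\sum_(H in unlabelled l)
    \sum_(S : {set V} | iso (induced G S) (tagged H)) F S); last first.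
  apply: eq_bigr => H _; rewrite -sumr_const; apply: eq_big => S.
    by rewrite inE.
  exact: Ff.
rewrite (exchange_big_dep (fun S : {set V} => (0 < #|S| <= l)%N)) /=.
  apply: eq_bigr => S cardS.
  have cardT : #|{: {x | x \in S}}| = #|S| by rewrite card_sig; apply: eq_card.
  have [|H HP] := @unlabelled_iso_unique _ (induced G S) l; first by rewrite cardT.
  by rewrite (big_pred1 H HP).
move=> H S XH /card_iso_induced ->; rewrite card_ord (leq_ord (tag H)) andbT.
have /subsetP/(_ _ XH) := transversal_sub (unlabelled_transversal l).
by rewrite inE.
Qed.

(** * Traces of matrix products, and inclusion-exclusion signs *)

Lemma prod_mx_walks (R : pzSemiRingType) (n k : nat) (A : 'I_k -> 'M[R]_n)
    (i j : 'I_n) :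
  (\prod_(a < k) A a) i j
  = \sum_(v : k.+1.-tuple 'I_n | (tnth v ord0 == i) && (tnth v ord_max == j))
      \prod_(a < k) A a (tnth v (widen_ord (leqnSn k) a)) (tnth v (lift ord0 a)).
Proof.
elim: k A i => [|k IHk] A i.
  (* The empty product is the identity matrix, and its walks are the one-entry tuples. *)
  rewrite big_ord0 -idmxE mxE (reindex_onto (fun x => [tuple x]) (fun v => thead v)) /=.
    rewrite (eq_bigl (fun x => (x == i) && (x == j))); last first.
      by move=> x; rewrite !(tnth_nth i) /= theadE eqxx andbT.
    under eq_bigr do rewrite big_ord0.
    have [->|neq_ij] := eqVneq i j.
      by rewrite (big_pred1 j) // => x; rewrite andbb.
    by rewrite big_pred0 // => x; have [->|//] := eqVneq x i; apply/negbTE.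
  by move=> v _; apply: eq_from_tnth => a; rewrite (ord1 a) tnth0.
rewrite big_ord_recl -mulmxE mxE.
under eq_bigr do rewrite IHk big_distrr /=.
rewrite (exchange_big_dep (fun v : k.+1.-tuple 'I_n => tnth v ord_max == j)) /=;
  last by move=> x v _ /andP[].
(* A walk from [i] is [i] followed by a shorter walk [v]; the summation index of the matrix product
   is the first entry of [v]. *)
rewrite (reindex_onto (fun v : k.+1.-tuple 'I_n => [tuple of i :: v])
                      (fun v => [tuple of behead v])) /=; last first.
  by move=> v /andP[/eqP <- _]; rewrite [RHS]tuple_eta.
apply: eq_big => [v|v vj].
  rewrite -[ord_max in RHS](_ : lift ord0 ord_max = _) ?tnthS; last exact: val_inj.
  by rewrite tnth0 eqxx /=; rewrite [X in _ && X](_ : _ = true) ?andbT //;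
     apply/eqP/val_inj.
rewrite (big_pred1 (tnth v ord0)) => [|x]; last by rewrite vj andbT eq_sym.
rewrite big_ord_recl; congr (A _ _ _ * _).
  by rewrite tnthS.
apply: eq_bigr => a _; congr (A _ _ _); last by rewrite tnthS.
rewrite -[widen_ord _ _ in RHS](_ : lift ord0 (widen_ord (leqnSn k) a) = _).
  by rewrite tnthS.
exact: val_inj.
Qed.

Lemma MmxE (V : finType) (G : graph V) (b : bool) i j :
  Mmx b G i j = (adj (if b then G else compl G) (enum_val i) (enum_val j))%:R.
Proof. by case: b; rewrite mxE. Qed.

Lemma trace_prod_Mmx (V : finType) (G : graph V) (k : nat) (beta : k.-tuple bool) :
  \tr (\prod_(i < k) Mmx (tnth beta i) G) = (num_closed_walks G beta)%:Z.
Proof.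
rewrite /mxtrace.
under eq_bigr do rewrite prod_mx_walks.
rewrite (exchange_big_dep (fun v : k.+1.-tuple 'I_#|V| => tnth v ord_max == tnth v ord0)) /=;
  last by move=> i v _ /andP[/eqP -> /eqP ->].
have enum_tuple_bij : bijective (map_tuple enum_val : k.+1.-tuple 'I_#|V| -> k.+1.-tuple V).
  exists (map_tuple enum_rank) => v; apply: eq_from_tnth => i; rewrite !tnth_map.
    exact: enum_valK.
  exact: enum_rankK.
rewrite /num_closed_walks -sum1dep_card (reindex _ (onW_bij _ enum_tuple_bij)) /=.
rewrite [in RHS]big_mkcond /= [in LHS]big_mkcond /= -natz natr_sum.
apply: eq_bigr => v _; rewrite /closed_walk !tnth_map (inj_eq enum_val_inj).
case: eqP => [v_closed|_] //=; rewrite (big_pred1 (tnth v ord0)); last first.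
  by move=> i; rewrite v_closed eq_sym andbb.
(* The product of 0/1 entries is 1 if every step is allowed, and one forbidden step makes it 0. *)
case: forallP => [walk_v|/forallP].
  by rewrite big1 // => i _; rewrite MmxE; move: (walk_v i); rewrite !tnth_map => ->.
rewrite negb_forall => /existsP[i]; rewrite !tnth_map => /negbTE not_adj.
by rewrite (bigD1 i) //= MmxE not_adj mul0r.
Qed.

(* Expand the product over x of 1 - [x \notin T] along the set S of the x for
   which the term 1 is chosen. *)
Lemma alternating_sum_supersets (V : finType) (T : {set V}) :
  \sum_(S : {set V} | T \subset S) (-1) ^+ (#|V| - #|S|) = (T == setT)%:R :> int.
Proof.
transitivity (\prod_(x : V) (1 + - (x \notin T)%:R) : int).
  rewrite bigA_distr [LHS]big_mkcond /=; apply: eq_bigr => S _.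
  rewrite (bigID (mem S)) /= big1 => [|x ->] //; rewrite mul1r.
  (* If [T] is contained in [S], each element outside [S] contributes -1; otherwise an element of
     [T] outside [S] contributes 0. *)
  case: subsetP => [sTS|].
    have -> : (#|V| - #|S|)%N = #|~: S| by rewrite [RHS]cardsCs setCK.
    rewrite -prodr_const.
    apply: eq_big => x; first by rewrite inE.
    by move=> Sx; rewrite (contraNN (sTS x)) ?ifN //; move: Sx; rewrite inE.
  move/subsetP/subsetPn => [x Tx Sx].
  by rewrite (bigD1 x) //= ifN // Tx oppr0 mul0r.
have [->|] := eqVneq; first by rewrite big1 // => x _; rewrite inE subr0.
rewrite -subTset => /subsetPn[x _ Tx].
by rewrite (bigD1 x) //= Tx subrr mul0r.
Qed.

(** * The two formulas *)

Lemma closed_walks_expansion (k : nat) (beta : k.-tuple bool) (V : finType)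
    (G : graph V) : (0 < k)%N ->
  num_closed_walks G beta
  = (\sum_(H in unlabelled k)
       num_surjective_closed_walks (tagged H) beta * ind (tagged H) G)%N.
Proof.
move=> k_gt0.
transitivity (\sum_(S : {set V} | (0 < #|S| <= k)%N)
    #|[set v | closed_walk G beta v && (walk_support v == S)]|)%N.
  rewrite /num_closed_walks -sum1dep_card.
  rewrite (partition_big (@walk_support V k) (fun S => 0 < #|S| <= k)%N) /=.
    by apply: eq_bigr => S _; rewrite sum1dep_card.
  by move=> v _; apply: walk_support_gt0.
rewrite (sum_unlabelled (G := G)
  (f := fun H : small_graph k => num_surjective_closed_walks (tagged H) beta)).
  by apply: eq_bigr => H _; rewrite -mulr_natr natn.
by move=> S H isoSH; rewrite (num_surjective_closed_walks_iso beta k_gt0 isoSH).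
Qed.

Lemma surjective_closed_walks_inversion (k : nat) (beta : k.-tuple bool)
    (W : finType) (H : graph W) : (0 < k)%N ->
  (num_surjective_closed_walks H beta)%:Z
  = \sum_(L in unlabelled #|W|)
      (-1) ^+ (#|W| - tag L)
      * \tr (\prod_(i < k) Mmx (tnth beta i) (tagged L))
      * (ind (tagged L) H)%:Z.
Proof.
move=> k_gt0.
transitivity (\sum_(S : {set W}) (-1) ^+ (#|W| - #|S|)
    * #|[set v | closed_walk H beta v && (walk_support v \subset S)]|%:R : int).
  under eq_bigr => S _.
    rewrite -sum1dep_card natr_sum big_distrr /=.
    under eq_bigr do rewrite mulr1.
    over.
  (* For a fixed walk, the signs over all [S] containing its support add up to 1 if the support is
     everything and to 0 otherwise. *)
  rewrite (exchange_big_dep (fun v => closed_walk H beta v)) /=;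
    last by move=> S v _ /andP[].
  rewrite -natz /num_surjective_closed_walks -sum1dep_card natr_sum big_mkcondr /=.
  apply: eq_bigr => v v_closed; rewrite v_closed /= alternating_sum_supersets.
  by rewrite /surjective_walk -/(walk_support v); case: eqP.
(* The empty set is split off because [unlabelled] has no empty graph; its term vanishes since every
   walk with [0 < k] has nonempty support. *)
rewrite (bigID (fun S : {set W} => (0 < #|S| <= #|W|)%N)) /= [X in _ + X]big1 => [|S].
  rewrite addr0 (sum_unlabelled (G := H) (f := fun L : small_graph #|W| =>
    (-1) ^+ (#|W| - tag L) * \tr (\prod_(i < k) Mmx (tnth beta i) (tagged L)))).
    by apply: eq_bigr => L _; rewrite -mulr_natr natz.
  move=> S L isoSL; rewrite trace_prod_Mmx (num_closed_walks_iso beta k_gt0 isoSL).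
  by rewrite (card_iso_induced isoSL) card_ord natz.
rewrite max_card andbT -eqn0Ngt cards_eq0 => /eqP ->.
rewrite (_ : [set v | _] = set0) ?cards0 ?mulr0 //; apply/setP => v.
rewrite !inE subset0 -cards_eq0.
by have /andP[/lt0n_neq0/negbTE -> _] := walk_support_gt0 v k_gt0; rewrite andbF.
Qed.

Theorem lemma3p2 (k : nat) (hk : (1 <= k)%N) (beta : k.-tuple bool)
    (V : finType) (G : graph V) :
  num_closed_walks G beta
    = (\sum_(H in unlabelled k)
         num_surjective_closed_walks (tagged H) beta * ind (tagged H) G)%N
  /\
  forall (W : finType) (H : graph W), (0 < #|W|)%N ->
    (num_surjective_closed_walks H beta)%:Z
      = \sum_(L in unlabelled #|W|)
          (-1) ^+ (#|W| - tag L)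
          * \tr (\prod_(i < k) Mmx (tnth beta i) (tagged L))
          * (ind (tagged L) H)%:Z.
Proof.
split; first exact: closed_walks_expansion.
by move=> W H _; apply: surjective_closed_walks_inversion.
Qed.
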